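(* Let $\mu,c\in\mathbb R$, $\tau>0$, $\kappa>0$, $\ell>0$, $a\ge 0$ and $h\in\mathbb R$. Let $\theta\sim N(\mu,\tau^{-1})$, and let $\varepsilon^S,\varepsilon^B\sim N(0,\kappa^{-1})$, with $\theta,\varepsilon^S,\varepsilon^B$ mutually independent. Put $$m^S=\frac{\tau\mu+\kappa(\theta+\varepsilon^S)}{\tau+\kappa},\qquad m^B=\frac{\tau\mu+\kappa(\theta+\varepsilon^B)}{\tau+\kappa},\qquad G=m^S-m^B,$$ $$\omega=\frac{\sqrt{2\kappa}}{\tau+\kappa},\qquad k=\frac{h}{\omega},\qquad M=\mu-\ell-c .$$ Then $$\operatorname{Cov}(m^S,G)=\frac{\kappa}{(\tau+\kappa)^2}=\frac{\omega^2}{2},$$ and the seller's exact expected current profit is $$\mathbb E\big[(m^S-\ell+a-c)\,\mathbf 1\{G\le h\}\big]=(M+a)\,\Phi(k)-\frac{\omega}{2}\,\phi(k).$$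
   Context: $\Phi$ and $\phi$ are the standard normal cumulative distribution function and density. Interpretation: the seller posts price $m^S-\ell+a$ at marginal cost $c$, and trade occurs exactly when $G\le h$. *)

(* Defs.v *)
From HB Require Import structures.
From mathcomp Require Export all_boot all_order all_algebra finmap.
From mathcomp Require Export all_classical all_reals all_analysis.

Set Implicit Arguments.
Unset Strict Implicit.
Unset Printing Implicit Defensive.

Import Order.TTheory GRing.Theory Num.Theory.
Import numFieldNormedType.Exports.

Local Open Scope classical_set_scope.
Local Open Scope ring_scope.

(* Mutual independence of a family of real random variables: the product rule
   for the events [X i \in A i], over every finite subfamily J. *)
Definition mutually_independent (R : realType) (d : measure_display)
    (T : measurableType d) (P : probability T R) (I : choiceType)
    (X : I -> {RV P >-> R}) : Prop :=
  forall (J : {fset I}) (A : I -> set R),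
    (forall i, i \in J -> measurable (A i)) ->
    (P (\bigcap_(i in [set` J]) (X i @^-1` A i)) =
     \prod_(i <- J) P (X i @^-1` A i))%E.

(* X ~ N(m, v), where v is the variance; [normal_prob] takes the standard
   deviation.  To be used with 0 < v only: in the degenerate case
   [normal_prob m 0] is not a Dirac mass but the uniform law on [0, 1]. *)
Definition normally_distributed (R : realType) (d : measure_display)
    (T : measurableType d) (P : probability T R) (X : {RV P >-> R})
    (m v : R) : Prop :=
  forall A : set R, measurable A ->
    distribution P X A = normal_prob m (Num.sqrt v) A.

Definition std_normal_cdf (R : realType) (x : R) : R :=
  fine (normal_prob 0 1 `]-oo, x]).

Definition std_normal_pdf (R : realType) (x : R) : R := normal_pdf 0 1 x.

(* Main.v *)
Require Import Defs.
From HB Require Import structures.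
From mathcomp Require Import all_boot all_order all_algebra.
From mathcomp Require Import all_classical all_reals all_analysis.
From mathcomp Require Import measurable_realfun ring lra.

(* With b = kappa / (tau + kappa) one has
   m^S = mu + b (theta - mu) + b eps^S  and  G = b (eps^S - eps^B), so trade
   occurs iff eps^S <= eps^B + t, where t = h / b. Since theta - mu is centred
   and independent of this event, the profit reduces to P(eps^S <= eps^B + t)
   and E[eps^S; eps^S <= eps^B + t]. Let s^2 = 1 / kappa and let phi_s be the
   density of N(0, s^2). As (- s^2 phi_s)'(x) = x phi_s(x), integrating over
   eps^S first gives - s^2 * int phi_s(y + t) phi_s(y) dy for the second
   quantity; completing the square,
   phi_s(y + t) phi_s(y) = phi_(sqrt 2 s)(t) phi_(s / sqrt 2)(y + t / 2),
   evaluates it as - s^2 phi_(sqrt 2 s)(t), and the same identity with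
   Tonelli gives the first one. In the covariance only b^2 Var(eps^S) = b^2 / kappa
   survives. *)

Set Implicit Arguments.
Unset Strict Implicit.
Unset Printing Implicit Defensive.

Import Order.TTheory GRing.Theory Num.Theory.
Import numFieldNormedType.Exports.

Local Open Scope classical_set_scope.
Local Open Scope ring_scope.

(** * Integrals against the normal density *)

Section normal_density_integral.
Local Open Scope ereal_scope.
Context (R : realType) (m s : R).
Local Notation lambda := (@lebesgue_measure R).

(** The Radon-Nikodym derivative of [normal_prob m s] and [normal_pdf m s] have the same integral
    over every measurable set, so they agree almost everywhere, and the abstract change of variables
    becomes an integral against the explicit density. *)
Lemma ge0_integral_normal_prob (f : R -> \bar R) :
    measurable_fun [set: R] f -> (forall x, 0 <= f x) ->
  \int[normal_prob m s]_x f x = \int[lambda]_x (f x * (normal_pdf m s x)%:E).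
Proof.
move=> mf f0; have dom := normal_prob_dominates m s.
rewrite -(Radon_Nikodym_SigmaFinite.change_of_variables dom)//.
have iRN := Radon_Nikodym_SigmaFinite.f_integrable dom.
have mpdf : measurable_fun [set: R] (fun x => (normal_pdf m s x)%:E).
  by apply/measurable_EFinP; exact: measurable_normal_pdf.
apply: ae_eq_integral => //.
- by apply: emeasurable_funM => //; exact: measurable_int iRN.
- exact: emeasurable_funM.
- apply: ae_eqe_mul2l; apply: integral_ae_eq => //.
  by move=> A _ mA; rewrite -Radon_Nikodym_SigmaFinite.f_integral.
Qed.

Lemma integrable_normal_prob (f : R -> R) : measurable_fun [set: R] f ->
  lambda.-integrable [set: R] (fun x => (f x * normal_pdf m s x)%:E) ->
  (normal_prob m s).-integrable [set: R] (EFin \o f).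
Proof.
move=> mf /integrableP[_ fi]; apply/integrableP; split; first exact/measurable_EFinP.
rewrite ge0_integral_normal_prob//; last first.
  by apply: measurableT_comp => //; exact/measurable_EFinP.
apply: le_lt_trans fi; rewrite le_eqVlt; apply/orP; left; apply/eqP.
apply: eq_integral => x _ /=.
by rewrite normrM (ger0_norm (normal_pdf_ge0 _ _ _)) EFinM.
Qed.

(** The nonnegative case applies to the positive and negative parts separately; the density, being
    nonnegative, can be moved inside each maximum with 0. *)
Lemma integral_normal_prob (f : R -> R) : measurable_fun [set: R] f ->
  lambda.-integrable [set: R] (fun x => (f x * normal_pdf m s x)%:E) ->
  \int[normal_prob m s]_x (f x)%:E = \int[lambda]_x (f x * normal_pdf m s x)%:E.
Proof.
move=> mf fi; have mEf : measurable_fun [set: R] (EFin \o f) by exact/measurable_EFinP.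
rewrite integralE [RHS]integralE; congr (_ - _).
- rewrite ge0_integral_normal_prob//; last exact: measurable_funepos.
  apply: eq_integral => x _; rewrite !funeposE /= -[in RHS](mul0e (normal_pdf m s x)%:E).
  by rewrite EFinM maxeMl// lee_fin normal_pdf_ge0.
- rewrite ge0_integral_normal_prob//; last exact: measurable_funeneg.
  apply: eq_integral => x _; rewrite !funenegE /= -[in RHS](mul0e (normal_pdf m s x)%:E).
  by rewrite maxe_pMl ?lee_fin ?normal_pdf_ge0// -EFinM mulNr.
Qed.

End normal_density_integral.

(** The truncations of [f] to [[a n, b n]] are dominated by its absolute value, so their integrals
    converge to the integral over [A]; by the fundamental theorem of calculus those integrals are
    also [F (b n) - F (a n)]. Keeping [A] general covers both a half-line, with [b] constant, and
    the whole line. *)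
Lemma integrable_FTC2 (R : realType) (f F : R -> R) (A : set R) (a b : R^nat) (l : R) :
  let lambda := (@lebesgue_measure R) in
  measurable A -> lambda.-integrable A (EFin \o f) -> continuous f ->
  (forall x : R, is_derive x 1 F (f x)) ->
  (forall n, a n < b n) -> (forall n, `[a n, b n] `<=` A) ->
  (forall x, A x -> \forall n \near \oo, x \in `[a n, b n]) ->
  F (b n) - F (a n) @[n --> \oo] --> l ->
  (\int[lambda]_(x in A) (f x)%:E = l%:E)%E.
Proof.
move=> lambda mA fi cf dF ab abA exh Fl.
have mf : measurable_fun A (EFin \o f) by exact: measurable_int fi.
pose g n x := (f x * \1_`[a n, b n] x)%:E.
have : (\int[lambda]_(x in A) g n x)%E @[n --> \oo] --> (\int[lambda]_(x in A) (f x)%:E)%E.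
  apply: (@dominated_cvg _ _ _ lambda _ mA g (EFin \o f) (abse \o (EFin \o f))) => //.
  - move=> n; apply/measurable_EFinP; apply: measurable_funM; first exact/measurable_EFinP.
    exact: measurable_indic.
  - move=> x Ax; apply: cvg_near_cst; apply: filterS (exh x Ax) => n xn.
    by rewrite /g indicE mem_set ?mulr1//.
  - exact: integrable_abse.
  - move=> n x Ax; rewrite /g /= lee_fin normrM ler_piMr// indicE.
    by case: (_ \in _); rewrite ?normr1 ?normr0.
have -> : (fun n => (\int[lambda]_(x in A) g n x)%E) = fun n => (F (b n) - F (a n))%:E.
  apply/funext => n.
  rewrite EFinB -(@continuous_FTC2 R f F (a n) (b n))//.
  - rewrite -[in RHS](setIidr (abA n)) integral_mkcondr; apply: eq_integral => x _.
    by rewrite /g patchE indicE; case: (x \in _); rewrite ?mulr1 ?mulr0.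
  - by apply: continuous_subspaceT.
  - have cF : continuous F.
      by move=> x; apply/differentiable_continuous/derivable1_diffP; case: (dF x).
    split.
    + by move=> x _; case: (dF x).
    + by apply: cvg_at_right_filter; exact: cF.
    + by apply: cvg_at_left_filter; exact: cF.
  - by move=> x _; rewrite derive1E; case: (dF x).
move=> /cvg_unique; apply => //.
by apply: cvg_EFin => //; exact: nearW.
Qed.

(** * First and second moments of the normal density *)

Section normal_moments.
Context (R : realType) (m s : R).
Hypothesis s0 : s != 0.
Local Notation lambda := (@lebesgue_measure R).

Lemma is_derive_normal_pdf (x : R) :
  is_derive x 1 (normal_pdf m s) (- (x - m) / s ^+ 2 * normal_pdf m s x).
Proof.
rewrite normal_pdfE// /normal_fun.
apply: is_derive_eq.
rewrite /= /GRing.scale /=.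
have : s ^+ 2 != 0 by rewrite expf_neq0.
set e := expR _; move=> s20.
by field.
Qed.

(* From [t <= expR t] with [t = (x - m)^2 / (4 s^2)]: half of the exponent
   absorbs the polynomial factor. *)
Lemma sqr_normal_pdf_le :
  exists2 C : R, 0 <= C & forall x,
    (x - m) ^+ 2 * normal_pdf m s x <= C * normal_pdf m (Num.sqrt 2 * s) x.
Proof.
have r0 : Num.sqrt 2 * s != 0 :> R by rewrite mulf_neq0// gt_eqF// sqrtr_gt0.
have p0 := normal_peak_gt0 r0.
(* The factor [4 * s ^+ 2] comes from [(x - m) ^+ 2 = 4 * s ^+ 2 * t]; the quotient of peaks
   replaces the normalisation of the wider density by that of the original one. *)
exists (4 * s ^+ 2 * normal_peak s / normal_peak (Num.sqrt 2 * s)) => [|x].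
  by rewrite divr_ge0 ?(ltW p0)// mulr_ge0 ?normal_peak_ge0// mulr_ge0// sqr_ge0.
rewrite !normal_pdfE// [leRHS]mulrA divfK ?gt_eqF//.
rewrite [leLHS]mulrCA -mulrA [leRHS]mulrCA ler_wpM2l ?normal_peak_ge0// /normal_fun.
have s2 : 0 < s ^+ 2 by rewrite exprn_even_gt0.
rewrite exprMn sqr_sqrtr//.
set t := (x - m) ^+ 2 / (4 * s ^+ 2).
have -> : - (x - m) ^+ 2 / (s ^+ 2 *+ 2) = - t + - t.
  by rewrite /t; field.
have -> : - (x - m) ^+ 2 / (2 * s ^+ 2 *+ 2) = - t.
  by rewrite /t; field.
have -> : (x - m) ^+ 2 = 4 * s ^+ 2 * t.
  by rewrite /t; field.
rewrite expRD mulrA ler_wpM2r ?expR_ge0// -[leRHS]mulr1 -(mulrA (4 * s ^+ 2)).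
rewrite ler_wpM2l ?(mulr_ge0 _ (ltW s2))// expRN ler_pdivrMr ?expR_gt0// mul1r.
by rewrite (le_trans _ (expR_ge1Dx t))// lerDr.
Qed.

(** One factor [|u n - m|] of the bounded quantity [(u n - m) ^+ 2 * normal_pdf m s (u n)] is traded
    for [n.+1], which leaves a multiple of the harmonic sequence. Both limits serve as boundary
    terms of the improper integrals below. *)
Lemma normal_pdf_tail (u : R^nat) : (forall n, n.+1%:R <= `|u n - m|) ->
  normal_pdf m s (u n) @[n --> \oo] --> (0 : R) /\
  (u n - m) * normal_pdf m s (u n) @[n --> \oo] --> (0 : R).
Proof.
move=> un.
have r0 : Num.sqrt 2 * s != 0 :> R by rewrite mulf_neq0// gt_eqF// sqrtr_gt0.
have [C C0 HC] := sqr_normal_pdf_le.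
have pge0 n := normal_pdf_ge0 m s (u n).
have lim0 : C * normal_peak (Num.sqrt 2 * s) * harmonic n @[n --> \oo] --> (0 : R).
  rewrite -[X in _ --> X](mulr0 (C * normal_peak (Num.sqrt 2 * s))).
  by apply: cvgMl_tmp; exact: cvg_harmonic.
have un0 n : 0 < `|u n - m| by apply: lt_le_trans (un n).
have bnd n : `|u n - m| * normal_pdf m s (u n) <=
    C * normal_peak (Num.sqrt 2 * s) * harmonic n.
  rewrite /harmonic ler_pdivlMr// (le_trans _ (_ : (u n - m) ^+ 2 * normal_pdf m s (u n) <= _))//.
    rewrite -real_normK ?num_real// expr2 -[leRHS]mulrA [leRHS]mulrC.
    by rewrite ler_wpM2l// mulr_ge0.
  by rewrite (le_trans (HC _))// ler_wpM2l// normal_pdf_ub.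
split.
- apply: squeeze_cvgr (cvg_cst 0) lim0; apply: nearW => n; rewrite pge0/=.
  rewrite (le_trans _ (bnd n))// ler_peMl// (le_trans _ (un n))//.
  by rewrite ler1n.
- apply/norm_cvg0P; apply: squeeze_cvgr (cvg_cst 0) lim0; apply: nearW => n.
  by rewrite normr_ge0/= normrM (ger0_norm (pge0 n)).
Qed.

Lemma integrable_sqr_normal_pdf :
  lambda.-integrable [set: R] (fun x => ((x - m) ^+ 2 * normal_pdf m s x)%:E).
Proof.
have [C C0 HC] := sqr_normal_pdf_le.
have iC : lambda.-integrable [set: R] (fun x => (C%:E * (normal_pdf m (Num.sqrt 2 * s) x)%:E)%E).
  by apply: integrableZl => //; exact: integrable_normal_pdf.
apply: (le_integrable _ _ _ iC) => //.
  apply/measurable_EFinP; apply: measurable_funM; last exact: measurable_normal_pdf.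
  by apply: measurable_funX; exact: measurable_funB.
move=> x _ /=; rewrite lee_fin !ger0_norm//.
- by rewrite mulr_ge0// normal_pdf_ge0.
- by rewrite mulr_ge0 ?sqr_ge0 ?normal_pdf_ge0.
Qed.

(** Domination through [|x - m| <= 1 + (x - m) ^+ 2]. *)
Lemma integrable_id_normal_pdf :
  lambda.-integrable [set: R] (fun x => ((x - m) * normal_pdf m s x)%:E).
Proof.
have iD := integrableD measurableT (integrable_normal_pdf m s) integrable_sqr_normal_pdf.
apply: (le_integrable _ _ _ iD) => //.
  apply/measurable_EFinP; apply: measurable_funM; last exact: measurable_normal_pdf.
  exact: measurable_funB.
move=> x _ /=; have p0 := normal_pdf_ge0 m s x.
rewrite lee_fin [leRHS]ger0_norm ?(addr_ge0 p0) ?(mulr_ge0 (sqr_ge0 _) p0)//.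
have h : `|x - m| <= 1 + (x - m) ^+ 2.
  rewrite -[(x - m) ^+ 2]real_normK ?num_real//.
  by have := sqr_ge0 (`|x - m| - 1); have := normr_ge0 (x - m); nra.
by rewrite normrM (ger0_norm p0) (le_trans (ler_wpM2r p0 h))// mulrDl mul1r.
Qed.

Lemma continuous_normal_pdfM (k : nat) : continuous (fun x : R => (x - m) ^+ k * normal_pdf m s x).
Proof.
move=> x; apply: cvgM; last exact: continuous_normal_pdf.
apply: (@continuous_comp _ _ _ (fun x => x - m) (fun x => x ^+ k)).
  exact: cvgB cvg_id (cvg_cst _).
exact: exprn_continuous.
Qed.

(** The exponent [^+ 1] keeps the integrand an instance of [continuous_normal_pdfM]. *)
Let is_derive_primitive1 (x : R) :
  is_derive x 1 (fun x => - s ^+ 2 * normal_pdf m s x) ((x - m) ^+ 1 * normal_pdf m s x).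
Proof.
have dp := is_derive_normal_pdf x.
apply: is_derive_eq; rewrite /GRing.scale/=.
by field.
Qed.

Let is_derive_primitive2 (x : R) :
  is_derive x 1 (fun x => - s ^+ 2 * ((x - m) * normal_pdf m s x))
    ((x - m) ^+ 2 * normal_pdf m s x - s ^+ 2 * normal_pdf m s x).
Proof.
have dp := is_derive_normal_pdf x.
apply: is_derive_eq; rewrite /GRing.scale/=.
by field.
Qed.

Lemma integral_id_normal_pdf_Ny (r : R) :
  (\int[lambda]_(x in `]-oo, r]) ((x - m) * normal_pdf m s x)%:E =
   (- s ^+ 2 * normal_pdf m s r)%:E)%E.
Proof.
(* The minimum puts [a n] below [r], as an interval endpoint must be, and at distance at least
   [n.+1] from [m], as the tail estimate requires. *)
pose a n := Num.min r m - n.+1%:R.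
have am n : n.+1%:R <= `|a n - m|.
  have mm : Num.min r m <= m by rewrite ge_min lexx orbT.
  have n0 : 0 <= n.+1%:R :> R by [].
  by rewrite distrC ger0_norm /a; lra.
have rm : Num.min r m <= r by rewrite ge_min lexx.
apply: (@integrable_FTC2 _ (fun x => (x - m) ^+ 1 * normal_pdf m s x)
  (fun x => - s ^+ 2 * normal_pdf m s x) _ a (fun=> r)) => //.
- exact: integrableS integrable_id_normal_pdf.
- exact: continuous_normal_pdfM.
- by move=> n; rewrite /a; have : 0 < n.+1%:R :> R by []; lra.
- by move=> n x /=; rewrite !in_itv/= => /andP[].
- move=> x /=; rewrite in_itv/= => xr.
  near=> n; rewrite in_itv/= xr andbT /a lerBlDl -lerBlDr.
  rewrite (@le_trans _ _ n%:R) ?ler_nat//; near: n.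
  exact: nbhs_infty_ger.
- rewrite -[X in _ --> X]subr0; apply: cvgB; first exact: cvg_cst.
  rewrite -[X in _ --> X](mulr0 (- s ^+ 2)); apply: cvgMl_tmp.
  by have [] := normal_pdf_tail am.
Unshelve. all: end_near. Qed.

Let a (n : nat) := m - n.+1%:R.
Let b (n : nat) := m + n.+1%:R.

Let a_tail n : n.+1%:R <= `|a n - m|.
Proof. by rewrite /a addrAC subrr sub0r normrN normr_nat. Qed.

Let b_tail n : n.+1%:R <= `|b n - m|.
Proof. by rewrite /b addrAC subrr add0r normr_nat. Qed.

Let ab n : a n < b n.
Proof. by rewrite /a /b; have : 0 < n.+1%:R :> R by []; lra. Qed.

Let ab_exhaust (x : R) : \forall n \near \oo, x \in `[a n, b n].
Proof.
near=> n; rewrite in_itv/= /a /b -ler_distlC.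
rewrite (@le_trans _ _ n%:R) ?ler_nat//; near: n.
exact: nbhs_infty_ger.
Unshelve. all: end_near. Qed.

Lemma integral_id_normal_pdf :
  (\int[lambda]_x ((x - m) * normal_pdf m s x)%:E = 0)%E.
Proof.
apply: (@integrable_FTC2 _ (fun x => (x - m) ^+ 1 * normal_pdf m s x)
  (fun x => - s ^+ 2 * normal_pdf m s x) _ a b) => //.
- exact: integrable_id_normal_pdf.
- exact: continuous_normal_pdfM.
- rewrite -[X in _ --> X]subr0 -{1}(mulr0 (- s ^+ 2)) -[X in _ - X](mulr0 (- s ^+ 2)).
  have [pa xa] := normal_pdf_tail a_tail; have [pb xb] := normal_pdf_tail b_tail.
  by apply: cvgB; exact: cvgMl_tmp.
Qed.

(** Integration by parts: the primitive [- s ^+ 2 * ((x - m) * normal_pdf m s x)] vanishes at both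
    ends, so the second moment equals [s ^+ 2] times the total mass 1. *)
Lemma integral_sqr_normal_pdf :
  (\int[lambda]_x ((x - m) ^+ 2 * normal_pdf m s x)%:E = (s ^+ 2)%:E)%E.
Proof.
have ip := integrable_normal_pdf m s.
have iZ : lambda.-integrable [set: R] (fun x => ((s ^+ 2)%:E * (normal_pdf m s x)%:E)%E).
  exact: integrableZl.
have i2 := integrable_sqr_normal_pdf.
have : (\int[lambda]_x ((x - m) ^+ 2 * normal_pdf m s x - s ^+ 2 * normal_pdf m s x)%:E = 0)%E.
  apply: (@integrable_FTC2 R
    (fun x => (x - m) ^+ 2 * normal_pdf m s x - s ^+ 2 * normal_pdf m s x)
    (fun x => - s ^+ 2 * ((x - m) * normal_pdf m s x)) setT a b 0) => //.
  - exact: (integrableB measurableT i2 iZ).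
  - move=> x; apply: cvgB; first exact: continuous_normal_pdfM.
    by apply: cvgM; [exact: cvg_cst|exact: continuous_normal_pdf].
  - rewrite -[X in _ --> X]subr0 -{1}(mulr0 (- s ^+ 2)) -[X in _ - X](mulr0 (- s ^+ 2)).
    have [pa xa] := normal_pdf_tail a_tail; have [pb xb] := normal_pdf_tail b_tail.
    by apply: cvgB; exact: cvgMl_tmp.
under eq_integral do rewrite EFinB [X in (_ - X)%E]EFinM.
rewrite (integralB measurableT i2 iZ) integralZl//= integral_normal_pdf mule1.
(* The second moment is finite, so the equation can be solved for it among the reals. *)
rewrite -[X in (X - _)%E]fineK; last exact: integrable_fin_num i2.
rewrite -EFinB => -[/eqP]; rewrite subr_eq0 => /eqP <-.
by rewrite fineK//; exact: integrable_fin_num i2.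
Qed.

End normal_moments.

(** * Two independent centred normal variables *)

Section normal_rescaling.
Context (R : realType).
Local Notation lambda := (@lebesgue_measure R).

Lemma normal_peak_scale (s : R) : 0 < s -> normal_peak s = s^-1 * normal_peak 1.
Proof.
move=> s0; rewrite /normal_peak expr1n mul1r -mulrnAr sqrtrM ?sqr_ge0//.
by rewrite sqrtr_sqr gtr0_norm// invfM.
Qed.

Lemma normal_pdf_scale (m s x : R) : 0 < s ->
  normal_pdf m s x = s^-1 * normal_pdf 0 1 ((x - m) / s).
Proof.
move=> s0; have sn0 : s != 0 by rewrite gt_eqF.
rewrite !normal_pdfE ?oner_eq0// normal_peak_scale// -mulrA; congr (_ * (_ * expR _)).
by field.
Qed.

(** Standardisation: the increasing affine substitution [(x - m) / s] on a half-line. *)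
Lemma normal_prob_Ny (m s r : R) : 0 < s ->
  normal_prob m s `]-oo, r] = normal_prob 0 1 `]-oo, (r - m) / s].
Proof.
move=> s0; pose F (x : R) := (x - m) / s.
have dF (x : R) : is_derive x 1 F s^-1.
  apply: is_derive_eq; rewrite /GRing.scale/=. by rewrite subr0 mulr1 mulr0 add0r.
have F'E : F^`()%classic = cst s^-1.
  by apply/funext => x; rewrite derive1E; case: (dF x).
have cF : continuous F.
  by move=> x; apply/differentiable_continuous/derivable1_diffP; case: (dF x).
rewrite /normal_prob -/(F r).
rewrite (@increasing_ge0_integration_by_substitutionNy R F (normal_pdf 0 1) r).
- apply: eq_integral => x _; rewrite fctE /= F'E /= normal_pdf_scale//.
  by rewrite mulrC.
- by move=> x y _ _ xy; rewrite /F ltr_pM2r ?invr_gt0// ltrD2r.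
- by rewrite F'E => x _; exact: cst_continuous.
- by rewrite F'E; exact: is_cvg_cst.
- by rewrite F'E; exact: cvg_cst.
- split; first by move=> x _; case: (dF x).
  by apply: cvg_at_left_filter; exact: cF.
- by apply/gt0_cvgMlNy; [rewrite invr_gt0|exact: cvg_addrr_Ny].
- by apply: continuous_subspaceT; apply: continuous_normal_pdf; rewrite oner_eq0.
- by move=> x _; exact: normal_pdf_ge0.
Qed.

(* [(u + y)^2 + y^2 = u^2 / 2 + 2 (y + u / 2)^2]. *)
Lemma normal_pdf_complete_square (s u y : R) : 0 < s ->
  normal_pdf (- y) s u * normal_pdf 0 s y =
  normal_pdf 0 (Num.sqrt 2 * s) u * normal_pdf (- (u / 2)) (s / Num.sqrt 2) y.
Proof.
move=> s0; have q0 : 0 < Num.sqrt 2 :> R by rewrite sqrtr_gt0.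
have qs : 0 < Num.sqrt 2 * s by rewrite mulr_gt0.
have sq : 0 < s / Num.sqrt 2 by rewrite divr_gt0.
have sn0 : s != 0 by rewrite gt_eqF.
have q2 : Num.sqrt 2 ^+ 2 = 2 :> R by rewrite sqr_sqrtr.
rewrite !normal_pdfE ?gt_eqF// (normal_peak_scale s0) (normal_peak_scale qs).
rewrite (normal_peak_scale sq) [LHS]mulrACA [RHS]mulrACA -!expRD.
congr (_ * expR _).
  by field; rewrite sn0 gt_eqF.
by rewrite !exprMn exprVn q2; field.
Qed.

Lemma measurable_le_shift (t : R) :
  measurable [set z : R * R | z.2 <= z.1 + t].
Proof.
rewrite -[X in measurable X]setTI.
have mf : measurable_fun [set: R * R] (fun z : R * R => z.2 - z.1).
  by apply: measurable_funB; [exact: measurable_snd|exact: measurable_fst].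
have := mf measurableT `]-oo, t]%classic (measurable_itv _).
congr (measurable (_ `&` _)); apply/seteqP; split => z /=; rewrite in_itv/=.
  by rewrite lerBlDl.
by rewrite lerBlDl.
Qed.

Lemma xsection_le_shift (t y : R) :
  xsection [set z : R * R | z.2 <= z.1 + t] y = `]-oo, y + t]%classic.
Proof.
by apply/seteqP; split => x; rewrite /xsection/= inE/= in_itv/=.
Qed.

(** Trades a shift of the argument for a shift of the mean, the form in which the square is
    completed. *)
Lemma normal_pdf_opp_shift (s t y : R) : s != 0 ->
  normal_pdf 0 s (y + t) = normal_pdf (- y) s t.
Proof. by move=> s0; rewrite !normal_pdfE// /normal_fun subr0 opprK addrC. Qed.

End normal_rescaling.

Section normal_pair.
Local Open Scope ereal_scope.
Context (R : realType) (s t : R).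
Hypothesis s0 : (0 < s)%R.
Local Notation lambda := (@lebesgue_measure R).
Local Notation N := (normal_prob 0%R s).
Local Notation A := [set z : R * R | (z.2 <= z.1 + t)%R].

Let sn0 : s != 0%R. Proof. by rewrite gt_eqF. Qed.

(** This is the law of the difference [z.2 - z.1], of variance [2 * s ^+ 2]. With [u] standing for
    that difference, completing the square splits the joint density of [y] and [u] into the target
    density in [u] and a normal density in [y]. *)
Lemma product_normal_le_shift :
  (N \x N) A = normal_prob 0 (Num.sqrt 2 * s) `]-oo, t].
Proof.
have mH := measurable_fun_xsection N (@measurable_le_shift R t).
rewrite /product_measure1 ge0_integral_normal_prob//.
pose f (z : R * R) := (normal_pdf (- z.1) s z.2 * normal_pdf 0 s z.1)%:E.
have fE y u : f (y, u) = (normal_pdf 0 (Num.sqrt 2 * s) u *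
    normal_pdf (- (u / 2)) (s / Num.sqrt 2) y)%:E.
  by rewrite /f/= normal_pdf_complete_square.
have mf : measurable_fun [set: R * R] f.
  apply/measurable_EFinP.
  apply: (eq_measurable_fun (fun z : R * R => normal_pdf 0 s (z.1 + z.2) * normal_pdf 0 s z.1)%R).
    by move=> z _; rewrite /f/= normal_pdf_opp_shift.
  apply: measurable_funM; apply: measurableT_comp => //; try exact: measurable_normal_pdf.
  by apply: measurable_funD; [exact: measurable_fst|exact: measurable_snd].
have f0 z : 0 <= f z by rewrite lee_fin mulr_ge0 ?normal_pdf_ge0.
have mB : measurable [set z : R * R | (z.2 <= t)%R].
  rewrite -[X in measurable X]setTI.
  have := @measurable_snd _ _ R R measurableT `]-oo, t]%classic (measurable_itv _).
  by congr (measurable (_ `&` _)); apply/seteqP; split => z /=; rewrite in_itv/=.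
pose g (z : R * R) := f z * (\1_[set z : R * R | (z.2 <= t)%R] z)%:E.
have mg : measurable_fun [set: R * R] g.
  by apply: emeasurable_funM => //; apply/measurable_EFinP; exact: measurable_indic.
have g0 z : 0 <= g z by rewrite mule_ge0// lee_fin.
transitivity (\int[lambda]_y \int[lambda]_u g (y, u)).
  (* Passing to the standard law and back realises the translation [u = x - y]: the mass of []-oo, y
     + t]] under mean 0 is that of []-oo, t]] under mean [- y]. *)
  apply: eq_integral => y _ /=; rewrite xsection_le_shift normal_prob_Ny//.
  rewrite subr0 -[(y + t)%R]addrC -{1}(opprK y) -normal_prob_Ny// /normal_prob.
  rewrite -ge0_integralZr//=; last 3 first.
    by apply/measurable_EFinP; apply: measurable_funTS; exact: measurable_normal_pdf.
    by move=> x _; rewrite lee_fin normal_pdf_ge0.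
    by rewrite lee_fin normal_pdf_ge0.
  rewrite [LHS]integral_mkcond; apply: eq_integral => u _.
  rewrite patchE /g /f indicE/= EFinM.
  have -> : (u \in `]-oo, t]%classic) = ((y, u) \in [set z : R * R | (z.2 <= t)%R]).
    by apply/idP/idP; rewrite !inE/= ?in_itv.
  by case: ifPn => _; rewrite ?mule1 ?mule0.
(* Once [y] is the inner variable, its factor is a probability density and integrates to 1. *)
rewrite (@fubini_tonelli _ _ _ _ _ lambda lambda g mg g0).
transitivity (\int[lambda]_u ((normal_pdf 0 (Num.sqrt 2 * s) u)%:E * (\1_`]-oo, t] u)%:E)).
  apply: eq_integral => u _ /=; rewrite /g.
  have hi y : \1_[set z : R * R | (z.2 <= t)%R] (y, u) = \1_`]-oo, t] u :> R.
    by rewrite !indicE; congr (_%:R); congr nat_of_bool; apply/idP/idP; rewrite !inE/= ?in_itv.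
  under eq_integral do rewrite hi fE -EFinM mulrAC EFinM.
  rewrite ge0_integralZl//=.
  - by rewrite integral_normal_pdf mule1.
  - by apply/measurable_EFinP; exact: measurable_normal_pdf.
  - by move=> x _; rewrite lee_fin normal_pdf_ge0.
  - by rewrite lee_fin mulr_ge0 ?normal_pdf_ge0.
rewrite /normal_prob [RHS]integral_mkcond; apply: eq_integral => u _.
by rewrite patchE indicE; case: ifPn => _; rewrite ?mule1 ?mule0.
Qed.

Let integrable_centered :
  lambda.-integrable [set: R] (fun x => ((x - 0) * normal_pdf 0 s x)%:E) ->
  lambda.-integrable [set: R] (fun x => (x * normal_pdf 0 s x)%:E).
Proof. by under eq_fun do rewrite subr0. Qed.

Lemma integrable_snd_product_normal :
  (N \x N).-integrable [set: R * R] (fun z => (z.2)%:E).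
Proof.
have iN : N.-integrable [set: R] (EFin \o (fun x : R => x)).
  by apply: integrable_normal_prob => //; exact/integrable_centered/integrable_id_normal_pdf.
apply/integrable12ltyP; first by apply/measurable_EFinP; exact: measurable_snd.
rewrite /= integral_cst//= probability_setT mule1.
by have /integrableP[] := iN.
Qed.

Lemma integral_product_normal_le_shift :
  \int[N \x N]_z (z.2 * \1_A z)%:E =
  (- s ^+ 2 * normal_pdf 0 (Num.sqrt 2 * s) t)%:E.
Proof.
have mA := @measurable_le_shift R t.
have ig : (N \x N).-integrable [set: R * R] (fun z => (z.2 * \1_A z)%:E).
  under eq_fun do rewrite EFinM.
  apply: integrableMl => //; first exact: integrable_snd_product_normal.
  (* Boundedness is phrased with a filter that must be proper; the point [(0, 0)] shows that the
     domain is nonempty. *)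
  apply/ex_bound; first exact: (@globally_properfilter _ _ (0%R, 0%R)).
  exists 1%R => z _ /=; rewrite indicE; case: (_ \in _); by rewrite ?normr1 ?normr0.
rewrite -integral12_prod_meas1//.
transitivity (\int[N]_y (- s ^+ 2 * normal_pdf 0 s (y + t))%:E).
  apply: eq_integral => y _; rewrite /fubini_F.
  have mi : measurable_fun [set: R] (fun x : R => x * \1_`]-oo, (y + t)%R] x)%R.
    by apply: measurable_funM => //; exact: measurable_indic.
  have hi x : \1_A (y, x) = \1_`]-oo, (y + t)%R] x :> R.
    by rewrite !indicE; congr (_%:R).
  under eq_integral do rewrite /= hi.
  rewrite integral_normal_prob//; last first.
    under eq_fun do rewrite mulrAC EFinM.
    apply: integrableMl => //; first exact/integrable_centered/integrable_id_normal_pdf.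
    apply/ex_bound; first exact: (@globally_properfilter _ _ 0%R).
    by exists 1%R => z _ /=; rewrite indicE; case: (_ \in _); rewrite ?normr1 ?normr0.
  rewrite -[(- s ^+ 2 * normal_pdf 0 s (y + t))%:E]integral_id_normal_pdf_Ny//.
  rewrite [RHS]integral_mkcond; apply: eq_integral => x _.
  by rewrite patchE indicE subr0; case: ifPn => _; rewrite ?mulr1 ?mulr0 ?mul0r.
pose h y := ((- s ^+ 2 * normal_pdf 0 (Num.sqrt 2 * s) t)%:E *
    (normal_pdf (- (t / 2)) (s / Num.sqrt 2) y)%:E).
(* The dependence on [y] is confined to a normal density of mean [- (t / 2)], whose integral is
   1. *)
have hE y : (- s ^+ 2 * normal_pdf 0 s (y + t) * normal_pdf 0 s y)%:E = h y.
  by rewrite /h -EFinM -mulrA normal_pdf_opp_shift// normal_pdf_complete_square// mulrA.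
rewrite integral_normal_prob; first last.
- by under eq_fun do rewrite hE; apply: integrableZl => //; exact: integrable_normal_pdf.
- apply: measurable_funM => //; apply: measurableT_comp.
    exact: measurable_normal_pdf.
  exact: measurable_funD.
under eq_integral do rewrite hE.
rewrite integralZl//; last exact: integrable_normal_pdf.
by rewrite integral_normal_pdf mule1.
Qed.

End normal_pair.

(** * Independence and product laws *)

Section product_law.
Local Open Scope ereal_scope.
Context d d1 d2 (T : measurableType d) (T1 : measurableType d1)
  (T2 : measurableType d2) (R : realType) (P : probability T R).
Variables (m1 : {sigma_finite_measure set T1 -> \bar R})
  (m2 : {sigma_finite_measure set T2 -> \bar R}).
Variables (X : T -> T1) (Y : T -> T2).
Hypotheses (mX : measurable_fun [set: T] X) (mY : measurable_fun [set: T] Y).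

Let XY w := (X w, Y w).

Let mXY : measurable_fun [set: T] XY.
Proof. exact/measurable_fun_pair. Qed.

Let mXY_mixin := isMeasurableFun.Build _ _ _ _ _ mXY.
Let XY_mfun : {mfun T >-> (T1 * T2)%type} := HB.pack XY mXY_mixin.

(* Conditioning on [E] reduces the claim to uniqueness of the product measure. *)
Lemma product_law_restr (E : set T) : measurable E ->
  (forall A B, measurable A -> measurable B ->
    P (E `&` (X @^-1` A `&` Y @^-1` B)) = P E * (m1 A * m2 B)) ->
  forall C, measurable C -> P (E `&` XY @^-1` C) = P E * (m1 \x m2) C.
Proof.
move=> mE H C mC.
have mpre (D : set (T1 * T2)) : measurable D -> measurable (XY @^-1` D).
  by move=> mD; rewrite -[X in measurable X]setTI; exact: mXY.
have pfin : P E \is a fin_num by exact: fin_num_measure.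
(* A null [E] is treated apart, by monotonicity, because the next measure divides by [P E]. *)
have [p0|p0] := eqVneq (P E) 0.
  rewrite p0 mul0e; apply/eqP; rewrite eq_le measure_ge0 andbT -p0.
  by apply: le_measure; rewrite ?inE//; apply: measurableI => //; exact: mpre.
have fp0 : (0 <= (fine (P E))^-1)%R by rewrite invr_ge0 fine_ge0.
have pE : P E = (fine (P E))%:E by rewrite fineK.
have fpE : fine (P E) != 0%R by rewrite -eqe -pE.
(* [m'] is the conditional law of the pair given [E]; the hypothesis identifies it with the product
   measure on rectangles. *)
pose m' := pushforward (mscale (NngNum fp0) (mrestr P mE)) XY.
have m'E D : m' D = (fine (P E))^-1%:E * P (XY @^-1` D `&` E) by [].
have -> : (m1 \x m2) C = m' C.
  apply: product_measure_unique => // A B mA mB; rewrite -[LHS]/(m' _) m'E setIC.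
  have -> : XY @^-1` (A `*` B) = X @^-1` A `&` Y @^-1` B by [].
  by rewrite H// pE muleA -EFinM mulVf// mul1e.
by rewrite m'E {1}pE muleA -EFinM divff// mul1e setIC.
Qed.

Hypothesis law : forall A B, measurable A -> measurable B ->
  P (X @^-1` A `&` Y @^-1` B) = m1 A * m2 B.

Lemma product_lawE C : measurable C -> P (XY @^-1` C) = (m1 \x m2) C.
Proof.
move=> mC; have := @product_law_restr setT measurableT _ C mC.
rewrite setTI probability_setT mul1e; apply => A B mA mB.
by rewrite setTI mul1e law.
Qed.

Let lawE : forall C, measurable C -> C `<=` setT -> pushforward P XY_mfun C = (m1 \x m2) C.
Proof. by move=> C mC _; rewrite -product_lawE. Qed.

Lemma integrable_product_law (f : T1 * T2 -> \bar R) : measurable_fun [set: T1 * T2] f ->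
  (m1 \x m2).-integrable setT f -> P.-integrable setT (f \o XY).
Proof.
move=> mf /integrableP[_ fi]; apply/integrableP; split; first exact: measurableT_comp.
apply: le_lt_trans fi; rewrite -(eq_measure_integral _ lawE).
rewrite ge0_integral_pushforward//.
exact: measurableT_comp.
Qed.

Lemma integral_product_law (f : T1 * T2 -> \bar R) : measurable_fun [set: T1 * T2] f ->
  (m1 \x m2).-integrable setT f ->
  \int[P]_w f (X w, Y w) = \int[m1 \x m2]_z f z.
Proof.
move=> mf fi; rewrite -(eq_measure_integral _ lawE) integral_pushforward//.
exact: integrable_product_law.
Qed.

Variables (f : T1 -> R) (g : T2 -> R).
Hypotheses (fi : m1.-integrable setT (EFin \o f)) (gi : m2.-integrable setT (EFin \o g)).

Let mf : measurable_fun setT f.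
Proof. by apply/measurable_EFinP; exact: measurable_int fi. Qed.

Let mg : measurable_fun setT g.
Proof. by apply/measurable_EFinP; exact: measurable_int gi. Qed.

Let mfg : measurable_fun setT (fun z : T1 * T2 => (f z.1 * g z.2)%:E).
Proof.
by apply/measurable_EFinP; apply: measurable_funM; apply: measurableT_comp.
Qed.

(** The iterated integral of the absolute value factors into two finite integrals. *)
Lemma integrable_productM : (m1 \x m2).-integrable setT (fun z => (f z.1 * g z.2)%:E).
Proof.
apply/integrable12ltyP => //=.
have /integrableP[_ fl] := fi; have /integrableP[_ gl] := gi.
under eq_integral.
  move=> x _; under eq_integral do rewrite normrM EFinM.
  rewrite ge0_integralZl//=; last exact/measurable_EFinP/measurableT_comp.
  over.
rewrite ge0_integralZr//=; last 2 first.
- exact/measurable_EFinP/measurableT_comp.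
- exact: integral_ge0.
by rewrite lte_mul_pinfty// ?ge0_fin_numE//; exact: integral_ge0.
Qed.

Lemma integral_productM :
  \int[m1 \x m2]_z (f z.1 * g z.2)%:E = \int[m1]_x (f x)%:E * \int[m2]_y (g y)%:E.
Proof.
rewrite -integral12_prod_meas1; last exact: integrable_productM.
have gfin : \int[m2]_y (g y)%:E \is a fin_num by exact: integrable_fin_num gi.
rewrite -(fineK gfin) -integralZr//; apply: eq_integral => x _.
rewrite /fubini_F/= fineK//.
by under eq_integral do rewrite EFinM; rewrite integralZl.
Qed.

End product_law.

(** * A calculus of means *)

Section has_mean.
Local Open Scope ereal_scope.
Context d (T : measurableType d) (R : realType) (P : probability T R).
Implicit Types (f g : T -> R) (a b : R).

(** Bundling integrability with the value lets means be combined linearly without side conditions at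
    each step. *)
Definition has_mean f a :=
  P.-integrable [set: T] (EFin \o f) /\ \int[P]_w (f w)%:E = a%:E.

Lemma has_meanE f a : has_mean f a -> 'E_P[f] = a%:E.
Proof. by case=> _ fa; rewrite unlock. Qed.

Lemma has_mean_cst a : has_mean (fun=> a) a.
Proof.
split; last by rewrite integral_cst//= probability_setT mule1.
exact: finite_measure_integrable_cst.
Qed.

Lemma has_meanD f g a b : has_mean f a -> has_mean g b ->
  has_mean (fun w => f w + g w)%R (a + b)%R.
Proof.
move=> [fi fa] [gi gb]; split; first exact: (integrableD measurableT fi gi).
by under eq_integral do rewrite EFinD; rewrite integralD// fa gb.
Qed.

Lemma has_meanZ k f a : has_mean f a -> has_mean (fun w => k * f w)%R (k * a)%R.
Proof.
move=> [fi fa]; split; first exact: (integrableZl measurableT k fi).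
by under eq_integral do rewrite EFinM; rewrite integralZl// fa.
Qed.

Lemma eq_has_mean f g a b : has_mean f a -> f =1 g -> a = b -> has_mean g b.
Proof. by move=> fa /funext <- <-. Qed.

Lemma has_mean_covariance f g a b v : has_mean f a -> has_mean g b ->
  has_mean (fun w => (f w - a) * (g w - b))%R v -> covariance P f g = v%:E.
Proof.
move=> fa gb fgv; rewrite unlock (has_meanE fa) (has_meanE gb)/=.
by rewrite -(has_meanE fgv); congr expectation.
Qed.

Lemma has_mean_indic (A : set T) : measurable A -> has_mean \1_A (fine (P A)).
Proof.
move=> mA; split; last by rewrite integral_indic// setIT fineK// fin_num_measure.
exact: integrable_indic.
Qed.

End has_mean.

(** * Mean and variance of a normal random variable *)

Section normal_rv.
Local Open Scope ereal_scope.
Context d (T : measurableType d) (R : realType) (P : probability T R).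
Variables (X : {RV P >-> R}) (m v : R).
Hypotheses (v0 : (0 < v)%R) (HX : normally_distributed X m v).
Local Notation N := (normal_prob m (Num.sqrt v)).

Lemma normally_distributed_has_mean (f : R -> R) (a : R) : measurable_fun [set: R] f ->
  (@lebesgue_measure R).-integrable setT (fun x => (f x * normal_pdf m (Num.sqrt v) x)%:E) ->
  \int[@lebesgue_measure R]_x (f x * normal_pdf m (Num.sqrt v) x)%:E = a%:E ->
  has_mean P (f \o X) a.
Proof.
move=> mf fi fa.
have mX : @measurable_fun _ _ T (measurableTypeR R) setT X := measurable_funPT X.
have lawE (A : set (measurableTypeR R)) :
    measurable A -> A `<=` setT -> pushforward P (X : T -> measurableTypeR R) A = N A.
  by move=> mA _; exact: HX.
have /integrableP[_ Nf] := integrable_normal_prob mf fi.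
have mEf : @measurable_fun _ _ (measurableTypeR R) _ setT (EFin \o f).
  exact/measurable_EFinP.
have fXi : P.-integrable setT (EFin \o (f \o X)).
  apply/integrableP; split; first exact/measurable_EFinP/measurableT_comp.
  apply: le_lt_trans Nf; rewrite -(eq_measure_integral N lawE).
  rewrite ge0_integral_pushforward//.
  exact: measurableT_comp.
split=> //; rewrite -fa -integral_normal_prob// -(eq_measure_integral N lawE).
by rewrite integral_pushforward.
Qed.

Let s0 : Num.sqrt v != 0%R. Proof. by rewrite gt_eqF// sqrtr_gt0. Qed.

Lemma normally_distributed_centered : has_mean P (fun w => X w - m)%R 0.
Proof.
apply: (@normally_distributed_has_mean (fun x => x - m)%R) => //.
- exact: measurable_funB.
- exact: integrable_id_normal_pdf.
- exact: integral_id_normal_pdf.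
Qed.

Lemma normally_distributed_variance : has_mean P (fun w => (X w - m) ^+ 2)%R v.
Proof.
apply: (@normally_distributed_has_mean (fun x => (x - m) ^+ 2)%R) => //.
- by apply: measurable_funX; exact: measurable_funB.
- exact: integrable_sqr_normal_pdf.
- by rewrite integral_sqr_normal_pdf// sqr_sqrtr// ltW.
Qed.

Lemma integrable_normal_prob_centered : N.-integrable setT (fun x => (x - m)%:E).
Proof.
apply: (@integrable_normal_prob _ _ _ (fun x => x - m)%R).
  exact: measurable_funB.
exact: integrable_id_normal_pdf.
Qed.

Lemma integral_normal_prob_centered : \int[N]_x (x - m)%:E = 0.
Proof.
rewrite (@integral_normal_prob _ _ _ (fun x => x - m)%R).
- exact: integral_id_normal_pdf.
- exact: measurable_funB.
- exact: integrable_id_normal_pdf.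
Qed.

End normal_rv.

(** * Products of independent variables *)

Section independent_product.
Local Open Scope ereal_scope.
Context d d1 d2 (T : measurableType d) (T1 : measurableType d1)
  (T2 : measurableType d2) (R : realType) (P : probability T R).
Variables (m1 : {sigma_finite_measure set T1 -> \bar R})
  (m2 : {sigma_finite_measure set T2 -> \bar R}).
Variables (X : T -> T1) (Y : T -> T2).
Hypotheses (mX : measurable_fun [set: T] X) (mY : measurable_fun [set: T] Y).
Hypothesis law : forall A B, measurable A -> measurable B ->
  P (X @^-1` A `&` Y @^-1` B) = m1 A * m2 B.

Lemma has_mean_product_law (f : T1 * T2 -> R) (a : R) :
  measurable_fun setT f -> (m1 \x m2).-integrable setT (EFin \o f) ->
  \int[m1 \x m2]_z (f z)%:E = a%:E -> has_mean P (fun w => f (X w, Y w)) a.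
Proof.
move=> mf fi fa; have mEf : measurable_fun setT (EFin \o f) by exact/measurable_EFinP.
split; first exact: (integrable_product_law mX mY law mEf fi).
by rewrite -fa; exact: (integral_product_law mX mY law mEf fi).
Qed.

Lemma has_mean_productM0 (f : T1 -> R) (g : T2 -> R) :
  m1.-integrable setT (EFin \o f) -> m2.-integrable setT (EFin \o g) ->
  \int[m1]_x (f x)%:E = 0 -> has_mean P (fun w => f (X w) * g (Y w))%R 0%R.
Proof.
move=> fi gi f0; apply: (@has_mean_product_law (fun z => f z.1 * g z.2)%R).
- have /measurable_EFinP mf := measurable_int _ fi.
  have /measurable_EFinP mg := measurable_int _ gi.
  by apply: measurable_funM; apply: measurableT_comp.
- exact: integrable_productM.
- by rewrite integral_productM// f0 mul0e.
Qed.

End independent_product.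

Section independent_triple.
Local Open Scope ereal_scope.
Context d d1 d2 d3 (T : measurableType d) (T1 : measurableType d1)
  (T2 : measurableType d2) (T3 : measurableType d3) (R : realType) (P : probability T R).
Variables (m1 : probability T1 R) (m2 : probability T2 R) (m3 : probability T3 R).
Variables (X : T -> T1) (Y : T -> T2) (Z : T -> T3).
Hypotheses (mX : measurable_fun [set: T] X) (mY : measurable_fun [set: T] Y)
  (mZ : measurable_fun [set: T] Z).
Hypothesis law : forall A B C, measurable A -> measurable B -> measurable C ->
  P (X @^-1` A `&` (Y @^-1` B `&` Z @^-1` C)) = m1 A * (m2 B * m3 C).

Let law1 A : measurable A -> P (X @^-1` A) = m1 A.
Proof.
move=> mA; have := law mA measurableT measurableT.
by rewrite !preimage_setT !setIT !probability_setT !mule1.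
Qed.

Lemma pair_law12 A B : measurable A -> measurable B ->
  P (X @^-1` A `&` Y @^-1` B) = m1 A * m2 B.
Proof.
move=> mA mB; have := law mA mB measurableT.
by rewrite preimage_setT setIT probability_setT mule1.
Qed.

Lemma pair_law13 A C : measurable A -> measurable C ->
  P (X @^-1` A `&` Z @^-1` C) = m1 A * m3 C.
Proof.
move=> mA mC; have := law mA measurableT mC.
by rewrite preimage_setT setTI probability_setT mul1e.
Qed.

Lemma pair_law23 B C : measurable B -> measurable C ->
  P (Y @^-1` B `&` Z @^-1` C) = m2 B * m3 C.
Proof.
move=> mB mC; have := law measurableT mB mC.
by rewrite preimage_setT setTI probability_setT mul1e.
Qed.

Let law23 A C : measurable A -> measurable C ->
  P (X @^-1` A `&` (fun w => (Y w, Z w)) @^-1` C) = m1 A * (m2 \x m3) C.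
Proof.
move=> mA mC; rewrite -law1//.
have mXA : measurable (X @^-1` A) by rewrite -[X in measurable X]setTI; exact: mX.
rewrite (product_law_restr (m1 := m2) (m2 := m3) mY mZ mXA)//.
by move=> B C' mB mC'; rewrite law// law1.
Qed.

Lemma has_mean_indicM0 (f : T1 -> R) (C : set (T2 * T3)) :
  m1.-integrable setT (EFin \o f) -> \int[m1]_x (f x)%:E = 0 -> measurable C ->
  has_mean P (fun w => f (X w) * \1_C (Y w, Z w))%R 0%R.
Proof.
move=> fi f0 mC; have mYZ : measurable_fun setT (fun w => (Y w, Z w)).
  exact/measurable_fun_pair.
pose m23 : probability (T2 * T3)%type R := m2 \x m3.
have gi : m23.-integrable setT (EFin \o \1_C) by exact: integrable_indic.
exact: (@has_mean_productM0 _ _ _ _ _ _ _ _ m1 m23 X _ mX mYZ law23 f _ fi gi f0).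
Qed.

End independent_triple.

Lemma mutually_independent3 (R : realType) (d : measure_display) (T : measurableType d)
    (P : probability T R) (X Y Z : {RV P >-> R}) (A B C : set R) :
  mutually_independent (tnth [tuple X; Y; Z]) ->
  measurable A -> measurable B -> measurable C ->
  (P (X @^-1` A `&` (Y @^-1` B `&` Z @^-1` C)) =
   P (X @^-1` A) * (P (Y @^-1` B) * P (Z @^-1` C)))%E.
Proof.
move=> ind mA mB mC.
(* The default [setT] is never reached, as every index is below 3. *)
pose E (i : 'I_3) := nth setT [:: A; B; C] i.
pose J := [fset i in enum 'I_3]%fset.
have JT i : i \in J by rewrite in_fset/= mem_enum.
have := ind J E.
have -> : \bigcap_(i in [set` J]) (tnth [tuple X; Y; Z] i @^-1` E i) =
    X @^-1` A `&` (Y @^-1` B `&` Z @^-1` C).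
  apply/seteqP; split => w.
    move=> H; have {}H i : E i (tnth [tuple X; Y; Z] i w) by apply: H; exact: JT.
    have := H (@Ordinal 3 0 isT); have := H (@Ordinal 3 1 isT).
    by have := H (@Ordinal 3 2 isT); rewrite !(tnth_nth X)/=.
  by move=> [HA [HB HC]] i _; case: i => -[|[|[|//]]] hi.
move=> -> => [|i _]; last by case: i => -[|[|[|//]]].
(* A finite set enumerates its elements in an unspecified order, so the product is first permuted
   into the order of [enum 'I_3]. *)
have -> : (\prod_(i <- J) P (tnth [tuple X; Y; Z] i @^-1` E i) =
    \prod_(i <- enum 'I_3) P (tnth [tuple X; Y; Z] i @^-1` E i))%E.
  apply: perm_big; apply: uniq_perm; rewrite ?fset_uniq ?enum_uniq//.
  by move=> i; rewrite JT mem_enum.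
by rewrite big_enum/= !big_ord_recl big_ord0 mule1 !(tnth_nth X).
Qed.

(** * The seller's expected profit *)

Section gaussian_triple.
Context (R : realType) (d : measure_display) (T : measurableType d) (P : probability T R).
Variables (theta X Y : {RV P >-> R}) (mu u v : R).
Hypotheses (u0 : 0 < u) (v0 : 0 < v).
Hypotheses (theta_law : normally_distributed theta mu u)
  (X_law : normally_distributed X 0 v) (Y_law : normally_distributed Y 0 v)
  (ind : mutually_independent (tnth [tuple theta; X; Y])).
Local Notation N := (normal_prob 0 (Num.sqrt v)).
Local Notation M := (normal_prob mu (Num.sqrt u)).
(* [normal_prob] lives on [measurableTypeR R], whose measurable sets are those
   of [R] but whose display differs. *)
Local Notation TR := (measurableTypeR R).

Let mtheta : @measurable_fun _ _ T TR setT theta := measurable_funPT theta.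
Let mX : @measurable_fun _ _ T TR setT X := measurable_funPT X.
Let mY : @measurable_fun _ _ T TR setT Y := measurable_funPT Y.

(* [Y] comes before [X] so that, with [z = (Y w, X w)], the event
   [X w <= Y w + t] is [z.2 <= z.1 + t]. *)
Let law (A B C : set TR) : measurable A -> measurable B -> measurable C ->
  (P (theta @^-1` A `&` (Y @^-1` B `&` X @^-1` C)) = M A * (N B * N C))%E.
Proof.
move=> mA mB mC; rewrite -(theta_law mA) -(Y_law mB) -(X_law mC).
by rewrite [Y @^-1` _ `&` _]setIC mutually_independent3// [(P (X @^-1` _) * _)%E]muleC.
Qed.

Let law_thetaX := @pair_law13 _ _ _ _ _ TR TR TR _ _ M N N theta Y X law.
Let law_thetaY := @pair_law12 _ _ _ _ _ TR TR TR _ _ M N N theta Y X law.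
Let law_YX := @pair_law23 _ _ _ _ _ TR TR TR _ _ M N N theta Y X law.

Let cid : N.-integrable setT (fun x : TR => x%:E).
Proof.
have := integrable_normal_prob_centered 0 v0.
by under eq_fun do rewrite subr0.
Qed.

Let cid0 : (\int[N]_x x%:E = 0)%E.
Proof.
have := integral_normal_prob_centered 0 v0.
by under eq_integral do rewrite subr0.
Qed.

(** With the next two lemmas, this disposes of the cross terms in the expansion of the
    covariance. *)
Lemma has_mean_thetaX : has_mean P (fun w => (theta w - mu) * X w) 0.
Proof.
have thetai := integrable_normal_prob_centered mu u0.
have theta0 := integral_normal_prob_centered mu u0.
exact: (@has_mean_productM0 _ _ _ _ TR TR _ _ M N theta X mtheta mX law_thetaX
  (fun x => x - mu) id thetai cid theta0).
Qed.

Lemma has_mean_thetaY : has_mean P (fun w => (theta w - mu) * Y w) 0.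
Proof.
have thetai := integrable_normal_prob_centered mu u0.
have theta0 := integral_normal_prob_centered mu u0.
exact: (@has_mean_productM0 _ _ _ _ TR TR _ _ M N theta Y mtheta mY law_thetaY
  (fun x => x - mu) id thetai cid theta0).
Qed.

Lemma has_mean_YX : has_mean P (fun w => Y w * X w) 0.
Proof.
exact: (@has_mean_productM0 _ _ _ _ TR TR _ _ N N Y X mY mX law_YX id id cid cid cid0).
Qed.

Local Notation D t := [set w | X w <= Y w + t].

Let mA (t : R) : measurable [set z : TR * TR | z.2 <= z.1 + t].
Proof. exact: measurable_le_shift. Qed.

Let indicE' (t : R) w : \1_[set z : R * R | z.2 <= z.1 + t] (Y w, X w) = \1_(D t) w :> R.
Proof. by rewrite !indicE; congr (_%:R). Qed.

Lemma has_mean_le_shift (t : R) :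
  has_mean P \1_(D t) (std_normal_cdf (t / (Num.sqrt 2 * Num.sqrt v))).
Proof.
have mD : measurable (D t).
  have := @measurable_fun_pair _ _ _ _ _ _ _ _ mY mX measurableT _ (mA t).
  by rewrite setTI.
rewrite /std_normal_cdf -[X in (X / _)]subr0 -normal_prob_Ny; last first.
  by rewrite mulr_gt0// sqrtr_gt0.
rewrite -product_normal_le_shift ?sqrtr_gt0//.
rewrite -(product_lawE mY mX law_YX (mA t)).
exact: has_mean_indic.
Qed.

Lemma has_mean_X_le_shift (t : R) : has_mean P (fun w => X w * \1_(D t) w)
  (- v * normal_pdf 0 (Num.sqrt 2 * Num.sqrt v) t).
Proof.
pose f (z : TR * TR) : R := z.2 * \1_[set z : R * R | z.2 <= z.1 + t] z.
have mf : measurable_fun setT f.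
  exact: measurable_funM.
have sv0 : 0 < Num.sqrt v by rewrite sqrtr_gt0.
have fi : (N \x N)%E.-integrable setT (fun z => (f z)%:E).
  under eq_fun do rewrite /f EFinM.
  apply: integrableMl => //; first exact: (integrable_snd_product_normal sv0).
  apply/ex_bound; first exact: (@globally_properfilter _ _ (0, 0)).
  by exists 1 => z _ /=; rewrite indicE; case: (_ \in _); rewrite ?normr1 ?normr0.
have fE := integral_product_normal_le_shift t sv0.
have := @has_mean_product_law _ _ _ _ TR TR _ _ N N Y X mY mX law_YX f _ mf fi fE.
by rewrite sqr_sqrtr ?(ltW v0).
Qed.

(** The event depends on the pair [(Y, X)] only, of which the centred [theta] is independent. *)
Lemma has_mean_theta_le_shift (t : R) :
  has_mean P (fun w => (theta w - mu) * \1_(D t) w) 0.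
Proof.
have thetai := integrable_normal_prob_centered mu u0.
have theta0 := integral_normal_prob_centered mu u0.
have H := @has_mean_indicM0 _ _ _ _ _ TR TR TR _ _ M N N theta Y X mtheta mY mX law
  (fun x => x - mu) _ thetai theta0 (mA t).
by apply: eq_has_mean H _ _ => // w; rewrite indicE'.
Qed.

End gaussian_triple.

Theorem mainTheorem2 (R : realType) (mu c tau kappa ell a h : R)
    (d : measure_display) (T : measurableType d) (P : probability T R)
    (theta epsS epsB : {RV P >-> R}) :
  0 < tau -> 0 < kappa -> 0 < ell -> 0 <= a ->
  normally_distributed theta mu tau^-1 ->
  normally_distributed epsS 0 kappa^-1 ->
  normally_distributed epsB 0 kappa^-1 ->
  mutually_independent (tnth [tuple theta; epsS; epsB]) ->
  let mS : T -> R := fun w =>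
    (tau * mu + kappa * (theta w + epsS w)) / (tau + kappa) in
  let mB : T -> R := fun w =>
    (tau * mu + kappa * (theta w + epsB w)) / (tau + kappa) in
  let G : T -> R := fun w => mS w - mB w in
  let omega : R := Num.sqrt (2 * kappa) / (tau + kappa) in
  let k : R := h / omega in
  let M : R := mu - ell - c in
  [/\ covariance P mS G = (kappa / (tau + kappa) ^+ 2)%:E,
      kappa / (tau + kappa) ^+ 2 = omega ^+ 2 / 2
    & expectation P (fun w => (mS w - ell + a - c) * \1_[set w' | G w' <= h] w)
      = ((M + a) * std_normal_cdf k - omega / 2 * std_normal_pdf k)%:E].
Proof.
move=> tau0 kappa0 _ _ theta_law epsS_law epsB_law ind mS mB G omega k M.
have den0 : 0 < tau + kappa by rewrite addr_gt0.
have den_neq0 : tau + kappa != 0 by rewrite gt_eqF.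
have kappaV0 : 0 < kappa^-1 by rewrite invr_gt0.
have tauV0 : 0 < tau^-1 by rewrite invr_gt0.
pose b := kappa / (tau + kappa); have b0 : 0 < b by rewrite divr_gt0.
(* With [q] and [r] as names for the radicals, the identities between constants become rational and
   fall to [field]. *)
pose q := Num.sqrt kappa; have q0 : 0 < q by rewrite sqrtr_gt0.
pose r := Num.sqrt 2 : R; have r0 : 0 < r by rewrite sqrtr_gt0.
have kappaE : kappa = q ^+ 2 by rewrite sqr_sqrtr// ltW.
have twoE : 2 = r ^+ 2 by rewrite sqr_sqrtr.
have sqrtV : Num.sqrt kappa^-1 = q^-1 by rewrite sqrtrV// ltW.
have omegaE : omega = r * q / (tau + kappa) by rewrite /omega sqrtrM.
have bE : b = q ^+ 2 / (tau + kappa) by rewrite -kappaE.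
have q_neq0 : q != 0 by rewrite gt_eqF.
have r_neq0 : r != 0 by rewrite gt_eqF.
have centered_theta := normally_distributed_centered tauV0 theta_law.
have mean_epsS : has_mean P epsS 0.
  by apply: eq_has_mean (normally_distributed_centered kappaV0 epsS_law) _ _ => // w; rewrite subr0.
have mean_epsB : has_mean P epsB 0.
  by apply: eq_has_mean (normally_distributed_centered kappaV0 epsB_law) _ _ => // w; rewrite subr0.
have var_epsS : has_mean P (fun w => epsS w ^+ 2) kappa^-1.
  by apply: eq_has_mean (normally_distributed_variance kappaV0 epsS_law) _ _ => // w; rewrite subr0.
have mSE w : mS w = mu + b * (theta w - mu) + b * epsS w by rewrite /mS /b; field.
have GE w : G w = b * epsS w + - b * epsB w by rewrite /G /mS /mB /b; field.
split.
- have mean_mS : has_mean P mS mu.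
    apply: eq_has_mean (has_meanD (has_meanD (has_mean_cst P mu) (has_meanZ b centered_theta))
      (has_meanZ b mean_epsS)) _ _ => [w|]; first by rewrite mSE.
    by rewrite !mulr0 !addr0.
  have mean_G : has_mean P G 0.
    apply: eq_has_mean (has_meanD (has_meanZ b mean_epsS) (has_meanZ (- b) mean_epsB)) _ _ => [w|].
      by rewrite GE.
    by rewrite !mulr0 addr0.
  apply: has_mean_covariance mean_mS mean_G _.
  have c1 := has_mean_thetaX tauV0 kappaV0 theta_law epsS_law epsB_law ind.
  have c2 := has_mean_thetaY tauV0 kappaV0 theta_law epsS_law epsB_law ind.
  have c3 := has_mean_YX kappaV0 theta_law epsS_law epsB_law ind.
  (* Expansion of [(b * (theta - mu) + b * epsS) * (b * epsS - b * epsB)]. *)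
  apply: eq_has_mean (has_meanZ (b ^+ 2) (has_meanD (has_meanD c1 (has_meanZ (- 1) c2))
    (has_meanD var_epsS (has_meanZ (- 1) c3)))) _ _ => [w|].
    by rewrite mSE GE /=; ring.
  rewrite /b; field.
  by rewrite den_neq0 gt_eqF.
- rewrite omegaE !exprMn -twoE -kappaE exprVn; field.
  exact: den_neq0.
- pose t := h / b.
  pose D := [set w | epsS w <= epsB w + t].
  have DE : [set w | G w <= h] = D.
    apply/seteqP; split => w /=; rewrite GE /t /D/= -lerBlDl ler_pdivlMr//; lra.
  (* [omega] is the standard deviation of [G], namely [b] times that of [epsS - epsB]. *)
  have kE : t / (Num.sqrt 2 * Num.sqrt kappa^-1) = k.
    rewrite /k /t bE sqrtV omegaE -/r; field.
    by rewrite q_neq0 r_neq0 den_neq0.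
  have i1 := has_mean_le_shift kappaV0 theta_law epsS_law epsB_law ind t.
  have i2 := has_mean_X_le_shift kappaV0 theta_law epsS_law epsB_law ind t.
  have i3 := has_mean_theta_le_shift tauV0 theta_law epsS_law epsB_law ind t.
  rewrite kE in i1.
  apply: has_meanE; rewrite DE.
  (* The margin splits as [(M + a) + b * (theta - mu) + b * epsS], each term being restricted to the
     trade event. *)
  apply: eq_has_mean (has_meanD (has_meanZ (M + a) i1)
    (has_meanD (has_meanZ b i3) (has_meanZ b i2))) _ _ => [w|].
    by rewrite /= mSE /M; ring.
  rewrite normal_pdf_scale ?mulr_gt0 ?sqrtr_gt0// subr0 kE -/(std_normal_pdf k).
  (* The coefficient is [b / (r * q) = q / (r * (tau + kappa))], which is [omega / 2] because
     [r ^+ 2 = 2]. *)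
  have -> : b * (- kappa^-1 * ((Num.sqrt 2 * Num.sqrt kappa^-1)^-1 * std_normal_pdf k)) =
      - (omega / 2 * std_normal_pdf k).
    rewrite sqrtV; have -> : kappa^-1 = (q ^+ 2)^-1 by rewrite -kappaE.
    rewrite bE omegaE -/r twoE; field.
    by rewrite q_neq0 r_neq0 den_neq0.
  by rewrite mulr0 add0r.
Qed.
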